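(* Let $n\ge 1$ and $0\le p\le n-1$. Then $$\operatorname{rank} I(n,p)=\begin{cases}1,&\text{if } p=0,\\ 2^n-1,&\text{if } p=1,\\ \displaystyle (n-2)+\sum_{r=p}^{n}\binom{n}{r}\binom{r-1}{p-1},&\text{if } p\in\{2,\dots,n-1\}.\end{cases}$$
   Context: Let $[n]=\{1,\dots,n\}$ with its usual order. A partial transformation of $[n]$ is a function $\rho$ whose domain $\mathrm{Dom}\,\rho$ and image $\mathrm{Im}\,\rho$ are subsets of $[n]$ (the empty map is allowed). Maps are written on the right and composed left to right: $x(\rho\sigma)=(x\rho)\sigma$. $\rho$ is isotone if $x\le y$ implies $x\rho\le y\rho$ for all $x,y\in\mathrm{Dom}\,\rho$; antitone if $x\le y$ implies $x\rho\ge y\rho$; monotone if isotone or antitone; decreasing if $x\rho\le x$ for all $x\in\mathrm{Dom}\,\rho$. $\mathcal{DORP}_n$ is the monoid, under composition, of all monotone and decreasing partial transformations of $[n]$. For $0\le p\le n-1$, $I(n,p)=\{\rho\in\mathcal{DORP}_n:|\mathrm{Im}\,\rho|\le p\}$, a two-sided ideal of $\mathcal{DORP}_n$. The rank of a finitely generated semigroup $S$ is $\min\{|T|:T\subseteq S,\ \langle T\rangle=S\}$, where $\langle T\rangle$ is the subsemigroup generated by $T$. *)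

(* Defs.v *)
From mathcomp Require Import all_boot.

Set Implicit Arguments.
Unset Strict Implicit.
Unset Printing Implicit Defensive.

Section Rank.
Variables (M : finType) (op : M -> M -> M).
Implicit Types S T U : {set M}.

Definition subsemigroup U := [forall x in U, forall y in U, op x y \in U].

Definition generated T : {set M} :=
  \bigcap_(U : {set M} | (T \subset U) && subsemigroup U) U.

Definition generates T S := (T \subset S) && (generated T == S).

(* When S is a subsemigroup, S generates itself, so the default S of arg min
   is a legitimate candidate and the value is the true minimum (rankP). *)
Definition rank S : nat := #|[arg min_(T < S | generates T S) #|T|]|.

Lemma generates_refl S : subsemigroup S -> generates S S.
Proof.
move=> sS; rewrite /generates subxx /= eqEsubset; apply/andP; split.
  by apply: (bigcap_inf S); rewrite subxx.
by apply/bigcapsP => U /andP[].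
Qed.

Lemma rankP S : subsemigroup S ->
  (exists2 T, generates T S & #|T| = rank S) /\
  (forall T, generates T S -> rank S <= #|T|).
Proof.
move=> /generates_refl gS; rewrite /rank.
by case: arg_minnP => // T gT minT; split; [exists T | exact: minT].
Qed.

End Rank.

(* The chain [n] = {1 < ... < n} is represented by 'I_n = {0 < ... < n.-1};
   x rho is undefined exactly when rho x = None. *)
Definition ptrans n := {ffun 'I_n -> option 'I_n}.

Section PartialTransformations.
Variable n : nat.
Implicit Types rho sigma tau : ptrans n.

Definition Im rho : {set 'I_n} := [set y | [exists x, rho x == Some y]].

(* Left-to-right composition: x (rho sigma) = (x rho) sigma. *)
Definition ptcomp rho sigma : ptrans n := [ffun x => obind sigma (rho x)].

Definition isotone rho :=
  [forall x : 'I_n, forall y : 'I_n, forall a : 'I_n, forall b : 'I_n,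
    [&& x <= y, rho x == Some a & rho y == Some b] ==> (a <= b)].

Definition antitone rho :=
  [forall x : 'I_n, forall y : 'I_n, forall a : 'I_n, forall b : 'I_n,
    [&& x <= y, rho x == Some a & rho y == Some b] ==> (b <= a)].

Definition monotone rho := isotone rho || antitone rho.

Definition decreasing rho :=
  [forall x : 'I_n, forall a : 'I_n, (rho x == Some a) ==> (a <= x)].

Definition DORP : {set ptrans n} := [set rho | monotone rho && decreasing rho].

Definition DORP_ideal p : {set ptrans n} := [set rho in DORP | #|Im rho| <= p].

Definition ptid : ptrans n := [ffun x => Some x].

Lemma ptcompA : associative ptcomp.
Proof.
move=> rho sigma tau; apply/ffunP => x; rewrite !ffunE.
by case: (rho x) => //= y; rewrite ffunE.
Qed.

Lemma ptcomp1l : left_id ptid ptcomp.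
Proof. by move=> rho; apply/ffunP => x; rewrite !ffunE. Qed.

Lemma ptcomp1r : right_id ptid ptcomp.
Proof.
by move=> rho; apply/ffunP => x; rewrite ffunE; case: (rho x) => //= y; rewrite ffunE.
Qed.

Lemma isotoneP rho :
  reflect (forall x y a b : 'I_n, x <= y -> rho x = Some a -> rho y = Some b -> a <= b)
          (isotone rho).
Proof.
apply: (iffP idP) => [H x y a b lexy ra rb | H].
  move/forallP/(_ x)/forallP/(_ y)/forallP/(_ a)/forallP/(_ b)/implyP: H; apply.
  by rewrite lexy ra rb !eqxx.
apply/forallP => x; apply/forallP => y; apply/forallP => a; apply/forallP => b.
apply/implyP => /and3P[lexy /eqP ra /eqP rb].
exact: H lexy ra rb.
Qed.

Lemma antitoneP rho :
  reflect (forall x y a b : 'I_n, x <= y -> rho x = Some a -> rho y = Some b -> b <= a)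
          (antitone rho).
Proof.
apply: (iffP idP) => [H x y a b lexy ra rb | H].
  move/forallP/(_ x)/forallP/(_ y)/forallP/(_ a)/forallP/(_ b)/implyP: H; apply.
  by rewrite lexy ra rb !eqxx.
apply/forallP => x; apply/forallP => y; apply/forallP => a; apply/forallP => b.
apply/implyP => /and3P[lexy /eqP ra /eqP rb].
exact: H lexy ra rb.
Qed.

Lemma decreasingP rho :
  reflect (forall x a : 'I_n, rho x = Some a -> a <= x) (decreasing rho).
Proof.
apply: (iffP idP) => [H x a ra | H].
  by move/forallP/(_ x)/forallP/(_ a)/implyP: H; apply; rewrite ra.
by apply/forallP => x; apply/forallP => a; apply/implyP => /eqP; exact: H.
Qed.

Lemma ptcompP rho sigma x b :
  ptcomp rho sigma x = Some b -> exists2 a, rho x = Some a & sigma a = Some b.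
Proof. by rewrite ffunE; case: (rho x) => //= a sa; exists a. Qed.

Lemma ptid_DORP : ptid \in DORP.
Proof.
rewrite inE; apply/andP; split; last by apply/decreasingP => x a; rewrite ffunE => -[->].
by apply/orP; left; apply/isotoneP => x y a b; rewrite !ffunE => ? [<-] [<-].
Qed.

Lemma DORP_subsemigroup : subsemigroup ptcomp DORP.
Proof.
apply/forall_inP => rho /[!inE] /andP[mr /decreasingP dr].
apply/forall_inP => sigma /[!inE] /andP[ms /decreasingP ds].
apply/andP; split; last first.
  apply/decreasingP => x b /ptcompP[a /dr ax /ds ba]; exact: leq_trans ba ax.
case/orP: mr => [/isotoneP | /antitoneP] mr; case/orP: ms => [/isotoneP | /antitoneP] ms;
  apply/orP; [left; apply/isotoneP | right; apply/antitoneP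
             | right; apply/antitoneP | left; apply/isotoneP];
  move=> x y c d lexy /ptcompP[a ra sa] /ptcompP[b rb sb];
  have := mr _ _ _ _ lexy ra rb => leab; by apply: ms leab _ _.
Qed.

Lemma card_Im_ptcompl rho sigma : #|Im (ptcomp rho sigma)| <= #|Im rho|.
Proof.
rewrite -(card_imset _ (@Some_inj _)).
apply: (@leq_trans #|[set sigma x | x in Im rho]|); last exact: leq_imset_card.
apply/subset_leq_card/subsetP => z /imsetP[y + ->].
rewrite inE => /existsP[x /eqP /ptcompP[a ra sa]]; rewrite -sa; apply: imset_f.
by rewrite inE; apply/existsP; exists x; rewrite ra.
Qed.

Lemma card_Im_ptcompr rho sigma : #|Im (ptcomp rho sigma)| <= #|Im sigma|.
Proof.
apply/subset_leq_card/subsetP => y /[!inE] /existsP[x /eqP /ptcompP[a _ sa]].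
by apply/existsP; exists a; rewrite sa.
Qed.

Lemma DORP_idealP p rho sigma : rho \in DORP -> sigma \in DORP_ideal p ->
  ptcomp rho sigma \in DORP_ideal p /\ ptcomp sigma rho \in DORP_ideal p.
Proof.
move=> Dr /setIdP[Ds lesp].
have DM tau ups : tau \in DORP -> ups \in DORP -> ptcomp tau ups \in DORP.
  by move=> Dt; apply/forall_inP: ups; apply: (forall_inP DORP_subsemigroup).
split; apply/setIdP; split; rewrite ?DM //.
  exact: leq_trans (card_Im_ptcompr _ _) lesp.
exact: leq_trans (card_Im_ptcompl _ _) lesp.
Qed.

Lemma DORP_ideal_subsemigroup p : subsemigroup ptcomp (DORP_ideal p).
Proof.
apply/forall_inP => rho /setIdP[Dr _]; apply/forall_inP => sigma Is.
exact: (DORP_idealP Dr Is).1.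
Qed.

End PartialTransformations.

Arguments ptcomp {n} rho sigma.
Arguments DORP n : clear implicits.
Arguments DORP_ideal n p : clear implicits.

(* Main.v *)
Require Import Defs.
From mathcomp Require Import all_boot.
From mathcomp Require Import zify.

(* Two families of generators are forced: the order-preserving idempotents of rank p, since
   such an idempotent can only be a product with itself as first factor, and, for each k
   other than 1 and n, one antitone non-isotone map fixing k. An order-preserving idempotent
   of rank p is a domain A together with a p-subset M of A containing min A (each x of A goes
   to the largest m <= x in M), which gives the sum of binomials. Conversely the idempotents
   generate all isotone maps of rank at most p, because p < n leaves room to lower one value
   by one while fixing the other ones; and every antitone map of the ideal is a truncated
   reflection about a point, multiplied by isotone maps on both sides. *)

Set Implicit Arguments.
Unset Strict Implicit.
Unset Printing Implicit Defensive.

(** * Cardinality facts about finite sets *)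

Lemma exists_intermediate_set (T : finType) (D B : {set T}) p :
  D \subset B -> #|D| <= p <= #|B| ->
  exists M : {set T}, [/\ D \subset M, M \subset B & #|M| = p].
Proof.
move=> DB; elim: p => [|p IHp] /andP[Dp pB].
  by exists D; split=> //; apply/eqP; rewrite -leqn0.
move: Dp; rewrite leq_eqVlt => /predU1P[Dp | Dp]; first by exists D.
have [|M [DM MB cardM]] := IHp; first by rewrite -ltnS Dp ltnW.
have /set0Pn[x /setDP[xB xM]] : B :\: M != set0.
  by rewrite -card_gt0 cardsD (setIidPr MB) cardM subn_gt0.
exists (x |: M); split; last by rewrite cardsU1 xM cardM.
  exact: subset_trans DM (subsetUr _ _).
by apply/subsetP => y /setU1P[-> //|]; apply: (subsetP MB).
Qed.

Lemma card_ord_range_le n k m : #|[set y : 'I_n | k <= y < m]| <= m - k.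
Proof.
rewrite cardE -(size_map val) -(size_iota k (m - k)); apply: uniq_leq_size.
  by rewrite map_inj_uniq ?enum_uniq //; apply: val_inj.
by move=> _ /mapP[y + ->]; rewrite mem_enum inE mem_iota /=; lia.
Qed.

(** * Generated subsemigroups and a criterion for forced generators *)

Section Generated.
Variables (M : finType) (op : M -> M -> M).
Implicit Types S T U : {set M}.

Lemma subset_generated T : T \subset generated op T.
Proof. by apply/bigcapsP => U /andP[]. Qed.

Lemma generated_subsemigroup T : subsemigroup op (generated op T).
Proof.
apply/forall_inP => x /bigcapP xT; apply/forall_inP => y /bigcapP yT.
apply/bigcapP => U TU; have /andP[_ sU] := TU.
exact: (forall_inP (forall_inP sU x (xT _ TU)) y (yT _ TU)).
Qed.

Lemma generated_min T U : subsemigroup op U -> T \subset U -> generated op T \subset U.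
Proof. by move=> sU TU; apply: bigcap_inf; rewrite TU. Qed.

(** If a product can satisfy [W] only when a factor does, the elements of [S] outside [W] form a
    subsemigroup. A generating set missing [W] would stay inside it and never reach [s]. *)
Lemma generates_meets T S (W : pred M) s :
  subsemigroup op S -> generates op T S -> s \in S -> W s ->
  (forall a b, a \in S -> b \in S -> W (op a b) -> W a || W b) ->
  exists2 t, t \in T & W t.
Proof.
move=> sS /andP[TS /eqP gT] Ss Ws Wop.
have [/exists_inP[t tT Wt] | noW] := boolP [exists t in T, W t]; first by exists t.
suff /subsetP/(_ s) : generated op T \subset [set x in S | ~~ W x].
  by rewrite gT inE Ws andbF => /(_ Ss).
apply: generated_min.
  apply/forall_inP => a /setIdP[Sa Wa]; apply/forall_inP => b /setIdP[Sb Wb].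
  apply/setIdP; split; first exact: (forall_inP (forall_inP sS a Sa) b Sb).
  by apply/negP => /(Wop _ _ Sa Sb); rewrite (negPf Wa) (negPf Wb).
apply/subsetP => t tT; apply/setIdP; split; first exact: (subsetP TS).
by move/exists_inPn: noW; apply.
Qed.

End Generated.

(** * Order-preserving idempotents: encoding, count and left factors *)

Section Retractions.
Variable n : nat.
Implicit Types (A D M : {set 'I_n}) (rho sigma tau : ptrans n).

Definition Dom rho : {set 'I_n} := [set x | rho x != None].

Lemma DomP rho x : reflect (exists y, rho x = Some y) (x \in Dom rho).
Proof.
by rewrite inE; case: (rho x) => [y|]; constructor; [exists y | case].
Qed.

Lemma ImP rho y : reflect (exists x, rho x = Some y) (y \in Im rho).
Proof. by rewrite inE; apply: existsPP => x; apply: eqP. Qed.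

Lemma notin_Dom rho x : x \notin Dom rho -> rho x = None.
Proof. by rewrite inE negbK => /eqP. Qed.

Lemma card_Im_le rho : #|Im rho| <= #|Dom rho|.
Proof.
rewrite -(card_imset _ (@Some_inj _)).
apply: (@leq_trans #|[set rho x | x in Dom rho]|); last exact: leq_imset_card.
apply/subset_leq_card/subsetP => _ /imsetP[y /ImP[x rx] ->].
by rewrite -rx imset_f //; apply/DomP; exists y.
Qed.

Lemma ptcompE rho sigma x a : rho x = Some a -> ptcomp rho sigma x = sigma a.
Proof. by rewrite ffunE => ->. Qed.

Lemma ptcompN rho sigma x : rho x = None -> ptcomp rho sigma x = None.
Proof. by rewrite ffunE => ->. Qed.

(** At most one [m] qualifies, the largest element of [M] below [x]. Points of [A] with no element
    of [M] below them fall outside the domain. *)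
Definition retract A M : ptrans n :=
  [ffun x => if x \in A
             then [pick m in M | (m <= x) && [forall m' in M, (m' <= x) ==> (m' <= m)]]
             else None].

Lemma retractP A M x m :
  retract A M x = Some m <->
  [/\ x \in A, m \in M, m <= x & forall m', m' \in M -> m' <= x -> m' <= m].
Proof.
rewrite ffunE; case: ifP => xA; last by split=> // -[].
case: pickP => [m' /and3P[Mm' m'x /forall_inP max'] | none]; split=> //.
- by case=> <-; split=> // k Mk; apply/implyP/max'.
- case=> _ Mm mx maxm; congr Some; apply/val_inj/anti_leq.
  by rewrite maxm //=; apply: (implyP (max' _ Mm)).
case=> _ Mm mx maxm; have /= := none m.
rewrite Mm mx /= => /negbT/negP[]; apply/forall_inP => k Mk; apply/implyP; exact: maxm.
Qed.

Lemma retract_def A M x m0 : x \in A -> m0 \in M -> m0 <= x ->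
  exists m, retract A M x = Some m.
Proof.
move=> xA Mm0 m0x.
have Pm0 : (m0 \in M) && (m0 <= x) by rewrite Mm0.
case: (@arg_maxnP _ m0 (fun m => (m \in M) && (m <= x)) (@nat_of_ord n) Pm0) => m /andP[Mm mx] maxm.
exists m; apply/retractP; split=> // k Mk kx; apply: maxm; exact/andP.
Qed.

Lemma retract_fix A M x : x \in A -> x \in M -> retract A M x = Some x.
Proof. by move=> xA Mx; apply/retractP; split. Qed.

Lemma retract_out A M x : x \notin A -> retract A M x = None.
Proof. by rewrite ffunE => /negPf->. Qed.

Lemma retract_isotone A M : isotone (retract A M).
Proof.
apply/isotoneP => x y a b xy /retractP[_ Ma ax _] /retractP[_ _ _]; apply=> //.
exact: leq_trans xy.
Qed.

Lemma retract_decreasing A M : decreasing (retract A M).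
Proof. by apply/decreasingP => x a /retractP[]. Qed.

Lemma Im_retract_sub A M : Im (retract A M) \subset M.
Proof. by apply/subsetP => y /ImP[x /retractP[]]. Qed.

(** The last condition makes the domain of [retract A M] all of [A], and the inclusion makes its
    image all of [M]; the pair can thus be read off the map. *)
Definition retract_pairs p : {set {set 'I_n} * {set 'I_n}} :=
  [set AM : {set 'I_n} * {set 'I_n} | [&& AM.2 \subset AM.1, #|AM.2| == p &
             [forall x in AM.1, exists m in AM.2, (m : nat) <= x]]].

Definition retractions p : {set ptrans n} :=
  [set retract AM.1 AM.2 | AM in retract_pairs p].

Lemma retract_pairsP p A M :
  reflect [/\ M \subset A, #|M| = p & forall x, x \in A -> exists2 m, m \in M & m <= x]
          ((A, M) \in retract_pairs p).
Proof.
rewrite inE /=; apply: (iffP and3P) => -[MA /eqP cM H]; split=> //.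
  by move=> x xA; apply/exists_inP/(forall_inP H).
by apply/forall_inP => x xA; apply/exists_inP/H.
Qed.

Lemma mem_retractions p A M :
  M \subset A -> #|M| = p -> (forall x, x \in A -> exists2 m, m \in M & m <= x) ->
  retract A M \in retractions p.
Proof. by move=> MA cM H; apply: (imset_f _ (x := (A, M))); apply/retract_pairsP. Qed.

Lemma Dom_retract A M :
  (forall x, x \in A -> exists2 m, m \in M & m <= x) -> Dom (retract A M) = A.
Proof.
move=> H; apply/setP => x; apply/DomP/idP => [[y /retractP[]] // | xA].
by have [m Mm mx] := H x xA; apply: retract_def mx.
Qed.

Lemma Im_retract A M : M \subset A -> Im (retract A M) = M.
Proof.
move=> /subsetP MA; apply/eqP; rewrite eqEsubset Im_retract_sub.
by apply/subsetP => m Mm; apply/ImP; exists m; rewrite retract_fix ?MA.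
Qed.

Lemma card_retractions p : #|retractions p| = #|retract_pairs p|.
Proof.
apply: card_in_imset => -[A M] [A' M'] /retract_pairsP[MA _ H] /retract_pairsP[MA' _ H'] /= eqr.
congr pair; first by rewrite -(Dom_retract H) eqr Dom_retract.
by rewrite -(Im_retract MA) eqr Im_retract.
Qed.

(* The blocks of a rank p order-preserving kernel on A are given by their minima M,
   and min A must be one of them. *)
Lemma card_retract_fiber p A : 0 < p ->
  #|[set M | (A, M) \in retract_pairs p]| = if p <= #|A| then 'C(#|A| - 1, p - 1) else 0.
Proof.
move=> p_gt0; have [pA | pA] := leqP; last first.
  apply/eqP; rewrite cards_eq0; apply/eqP/setP => M; rewrite !in_set0 in_set.
  by apply/retract_pairsP => -[/subset_leq_card MA cM _]; rewrite -cM ltnNge MA in pA.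
have /card_gt0P[x0 x0A] : 0 < #|A| by apply: leq_trans pA.
case: (@arg_minnP _ x0 (fun x => x \in A) (@nat_of_ord n) x0A) => a aA mina.
have -> : #|A| - 1 = #|A :\ a| by rewrite (cardsD1 a A) aA addKn.
(* Removing [a], the minimum of [A], turns the admissible [M] into the arbitrary (p-1)-subsets of
   [A :\ a]. *)
rewrite -cards_draws -[RHS](card_in_imset (f := fun M => a |: M)); last first.
  move=> M M' /setIdP[/subsetD1P[_ aM] _] /setIdP[/subsetD1P[_ aM'] _] /= eqU.
  by rewrite -(setU1K aM) eqU setU1K.
apply: eq_card => M; rewrite in_set; apply/retract_pairsP/imsetP.
  case=> MA cM H; have [m Mm] := H a aA.
  rewrite leq_eqVlt => /predU1P[/val_inj ma | ]; last first.
    by rewrite ltnNge mina ?(subsetP MA).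
  rewrite {}ma in Mm; exists (M :\ a); last by rewrite setD1K.
  by rewrite in_set setSD //= -(eqn_add2l 1) subnKC // -cM [in eqbRHS](cardsD1 a) Mm.
case=> M' /setIdP[/subsetD1P[MA aM] /eqP cM] ->; split.
- by apply/subsetP => x /setU1P[-> // | /(subsetP MA)].
- by rewrite cardsU1 aM cM subnKC.
by move=> x xA; exists a; [exact: setU11 | exact: mina].
Qed.

(** Pairs are sorted by [A], then by r = |A|: there are 'C(n, r) sets [A] of size r, all with
    equally many [M]. *)
Lemma card_retract_pairs p : 0 < p <= n ->
  #|retract_pairs p| = \sum_(p <= r < n.+1) 'C(n, r) * 'C(r - 1, p - 1).
Proof.
case/andP=> p_gt0 pn.
transitivity (\sum_(A : {set 'I_n}) #|[set M | (A, M) \in retract_pairs p]|).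
  rewrite -sum1_card (partition_big (fun AM => AM.1) xpredT) //=; apply: eq_bigr => A _.
  rewrite sum1dep_card -[RHS](card_imset _ (f := pair A)) => [|x y []] //.
  apply: eq_card => -[A' M]; rewrite in_set /=; apply/andP/imsetP.
    by case=> AM /eqP <-; exists M; rewrite // in_set.
  by case=> M0 + [-> ->]; rewrite in_set => AM0; split.
have cardT (A : {set 'I_n}) : #|A| < n.+1 by rewrite ltnS -[leqRHS]card_ord max_card.
rewrite (partition_big (fun A => Ordinal (cardT A)) xpredT) //=.
transitivity (\sum_(r < n.+1) if p <= r then 'C(n, r) * 'C(r - 1, p - 1) else 0).
  apply: eq_bigr => r _.
  under eq_bigr => A /eqP cA.
    rewrite card_retract_fiber //; have -> : #|A| = r by rewrite -cA. over.
  rewrite sum_nat_const; case: ifP; rewrite ?muln0 // => _; congr (_ * _).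
  by rewrite -[n in 'C(n, _)]card_ord -card_draws; apply: eq_card => A; rewrite [RHS]in_set.
rewrite -(big_mkord xpredT (fun r => if p <= r then 'C(n, r) * 'C(r - 1, p - 1) else 0)) -big_mkcond /=.
rewrite (big_cat_nat (n := p)) ?leqW //= big_nat_cond big1 ?add0n => [|r]; last by lia.
rewrite big_nat_cond [RHS]big_nat_cond; apply: eq_bigl => r; lia.
Qed.

(* Both factors fix M pointwise, so rho maps A into Im rho = M and sigma cannot move
   these values any further. *)
Lemma retract_left_factor p A M rho sigma :
  (A, M) \in retract_pairs p -> rho \in DORP_ideal n p -> sigma \in DORP_ideal n p ->
  ptcomp rho sigma = retract A M -> rho = retract A M.
Proof.
move=> /retract_pairsP[MA cM H] /setIdP[/setIdP[_ /decreasingP dr] cr].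
move=> /setIdP[/setIdP[_ /decreasingP ds] _] eqc.
have fixM m : m \in M -> rho m = Some m /\ sigma m = Some m.
  move=> Mm; have : ptcomp rho sigma m = Some m.
    by rewrite eqc retract_fix ?(subsetP MA).
  case/ptcompP => a ra sa; suff am : a = m by rewrite -{3}am -{2}am.
  by apply/val_inj/anti_leq; rewrite dr //= ds.
have ImM : Im rho = M.
  apply/eqP; rewrite eq_sym eqEcard cM cr andbT; apply/subsetP => m Mm.
  by apply/ImP; exists m; case: (fixM m Mm).
apply/ffunP => x; rewrite -eqc; case rx: (rho x) => [a|]; last by rewrite ptcompN.
rewrite (ptcompE _ rx); have : a \in M by rewrite -ImM; apply/ImP; exists x.
by case/fixM.
Qed.

End Retractions.

(** * The retractions of rank p generate all isotone maps of rank at most p *)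

Section IsotoneGeneration.
Variables (n p : nat) (G : {set ptrans n}).
Implicit Types (A D M : {set 'I_n}) (rho sigma tau : ptrans n).
Hypotheses (p_gt0 : 0 < p) (pn : p < n).
Hypotheses (sG : subsemigroup ptcomp G) (EG : retractions n p \subset G).

Lemma generated_comp rho sigma : rho \in G -> sigma \in G -> ptcomp rho sigma \in G.
Proof. by move=> Gr; apply/forall_inP: sigma; apply: (forall_inP sG). Qed.

(** Downward induction on |D|, starting from the retractions at size p. Below p there are two points
    [c], [d] outside [D], since p < n, and the identity of [D] is the product of those of [c |: D]
    and [d |: D]. *)
Lemma partial_identity_generated D : #|D| <= p -> retract D D \in G.
Proof.
move: {2}(p - #|D|) (leqnn (p - #|D|)) => k.
elim: k D => [|k IHk] D kD cD.
  apply: (subsetP EG); apply: mem_retractions => //; first by lia.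
  by move=> x xD; exists x.
have [pD | Dp] := leqP p #|D|; first by apply: IHk => //; lia.
have /card_gt1P[c [d [cNM dNM cd]]] : 1 < #|~: D|.
  by have := cardsC D; rewrite card_ord; lia.
rewrite !in_setC in cNM dNM.
have -> : retract D D = ptcomp (retract (c |: D) (c |: D)) (retract (d |: D) (d |: D)).
  apply/ffunP => x; rewrite [RHS]ffunE.
  have [xD | xND] := boolP (x \in D).
    by rewrite !(retract_fix, setU1r) //= retract_fix ?setU1r.
  rewrite [LHS]retract_out //; have [-> | xc] := eqVneq x c.
    by rewrite retract_fix ?setU11 //= retract_out // !inE negb_or cd.
  by rewrite retract_out // !inE negb_or xc.
by apply: generated_comp; apply: IHk; rewrite cardsU1 ?cNM ?dNM; lia.
Qed.

(** As p < n, [D] can be padded to a p-set [M] avoiding [c]. Retracting [c |: M] onto [M] sends [c]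
    to its predecessor [b] and fixes the rest. *)
Lemma shift_generated D (b c : 'I_n) : #|D| <= p -> b \in D -> c \notin D -> c = b.+1 :> nat ->
  exists tau, [/\ tau \in G, tau c = Some b & forall d, d \in D -> tau d = Some d].
Proof.
move=> Dp bD cD cb; have [||M [DM cM Mp]] := @exists_intermediate_set _ D (~: [set c]) p.
- by rewrite subsetC sub1set in_setC.
- by rewrite Dp cardsC1 card_ord; lia.
have cNM : c \notin M by apply/negP => /(subsetP cM); rewrite !inE eqxx.
have bM := subsetP DM b bD; have bc : b <= c by rewrite cb.
exists (retract (c |: M) M); split.
- apply/(subsetP EG)/mem_retractions => //; first exact: subsetUr.
  by move=> x /setU1P[-> | xM]; [exists b | exists x].
- apply/retractP; split=> //; first exact: setU11.
  move=> m Mm; rewrite leq_eqVlt => /predU1P[/val_inj mc | ]; last by rewrite cb.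
  by rewrite -mc Mm in cNM.
by move=> d /(subsetP DM) dM; rewrite retract_fix ?setU1r.
Qed.

(* Only the largest moved point is raised, by one, so that the domain is preserved and
   the value it reaches is not yet taken. *)
Lemma isotone_small_generated rho :
  isotone rho -> decreasing rho -> #|Dom rho| <= p -> rho \in G.
Proof.
(* Total displacement; the default [x] makes undefined points contribute 0, so displacement 0
   characterizes partial identities among decreasing maps. *)
pose disp rho := \sum_(x : 'I_n) (x - odflt x (rho x)).
move: {2}(disp rho) (leqnn (disp rho)) => k.
elim: k rho => [|k IHk] rho dk ir dr cr; move/isotoneP: (ir) => ir'; move/decreasingP: (dr) => dr'.
  have -> : rho = retract (Dom rho) (Dom rho).
    apply/ffunP => x; have [/[dup] xD /DomP[y ry] | xN] := boolP (x \in Dom rho).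
      rewrite retract_fix // ry; congr Some; apply/val_inj/anti_leq; rewrite dr' //= -subn_eq0.
      by move: dk; rewrite leqn0 sum_nat_eq0 => /forallP/(_ x)/implyP/(_ isT); rewrite ry.
    by rewrite retract_out // notin_Dom.
  exact: partial_identity_generated.
pose moved := [pred x : 'I_n | [exists a : 'I_n, (rho x == Some a) && (a < x)]].
have [x0 mx0 | nomoved] := pickP moved; last first.
  apply: IHk => //; rewrite [disp _]big1 // => x _; case rx: (rho x) => [a|] /=; last exact: subnn.
  by have := negbT (nomoved x) => /existsPn/(_ a); rewrite rx eqxx /= -leqNgt => /eqP.
have [x /existsP[b /andP[/eqP rx bx]] maxx] := arg_maxnP (@nat_of_ord n) mx0.
have ltbn : b.+1 < n by apply: leq_ltn_trans (ltn_ord x).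
pose c := Ordinal ltbn; have above y a : rho y = Some a -> x < y -> a = y.
  move=> ry xy; apply/val_inj/anti_leq; rewrite dr' //= leqNgt.
  apply/negP => ay; have /maxx : moved y by apply/existsP; exists a; rewrite ry eqxx.
  by rewrite /geq /= leqNgt xy.
(* A point above [x] with value [c] would be fixed, hence equal to [c], but c <= x; a point below
   [x] has value at most [b]. *)
have cNI : c \notin Im rho.
  apply/ImP => -[y ry]; case: (ltngtP x y) => [xy | yx | /val_inj xy].
  - have /(congr1 val)/= := above _ _ ry xy; lia.
  - by have /= := ir' _ _ _ _ (ltnW yx) ry rx; rewrite ltnn.
  - by move: ry; rewrite -xy rx => -[/(congr1 val)/=]; lia.
have [||||tau [Gt tc tfix]] := @shift_generated (Im rho) b c => //.
- exact: leq_trans (card_Im_le _) cr.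
- by apply/ImP; exists x.
pose rho' : ptrans n := [ffun y => if y == x then Some c else rho y].
have r'x : rho' x = Some c by rewrite ffunE eqxx.
have r'N y : y != x -> rho' y = rho y by rewrite ffunE => /negPf->.
have -> : rho = ptcomp rho' tau.
  apply/ffunP => y; have [-> | yx] := eqVneq y x; first by rewrite (ptcompE _ r'x) tc.
  case ry: (rho y) => [a|]; last by rewrite ptcompN // r'N.
  by rewrite (@ptcompE _ _ _ _ a) ?r'N // tfix //; apply/ImP; exists y.
apply: generated_comp Gt; apply: IHk.
- rewrite -ltnS; apply: leq_trans dk; rewrite /disp (bigD1 x) //= [ltnRHS](bigD1 x) //=.
  rewrite r'x rx /= -addSn leq_add //; first lia.
  by apply: leq_sum => y yx; rewrite r'N.
- apply/isotoneP => y z a d.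
  have [-> | yx] := eqVneq y x; have [-> | zx] := eqVneq z x; rewrite ?r'x ?r'N //.
  + by move=> _ [<-] [<-].
  + move=> xz [<-] rz; have ltxz : x < z.
      by rewrite ltn_neqAle xz andbT; apply: contraNneq zx => /val_inj->.
    by rewrite (above _ _ rz ltxz) /=; lia.
  + by move=> yx' ry [<-] /=; apply/leqW/(ir' _ _ _ _ yx' ry rx).
  + exact: ir'.
- apply/decreasingP => y a; have [-> | yx] := eqVneq y x; first by rewrite r'x => -[<-].
  by rewrite r'N //; apply: dr'.
suff -> : Dom rho' = Dom rho by [].
apply/setP => y; rewrite !inE; have [-> | yx] := eqVneq y x; first by rewrite r'x rx.
by rewrite r'N.
Qed.

(** [M] collects the least point of each kernel block, padded inside the domain to exactly p points.
    Then [rho] is the retraction onto [M] followed by its own restriction to [M], whose domain is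
    small enough for [isotone_small_generated]. *)
Lemma isotone_generated rho :
  isotone rho -> decreasing rho -> #|Im rho| <= p -> rho \in G.
Proof.
move=> ir dr cr; move/isotoneP: (ir) => ir'; move/decreasingP: (dr) => dr'.
have [Dp | pD] := leqP #|Dom rho| p; first exact: isotone_small_generated.
pose minima := [set x in Dom rho | [forall y : 'I_n, (rho y == rho x) ==> (x <= y)]].
have minD : minima \subset Dom rho by apply/subsetP => x /setIdP[].
have minimum x : x \in Dom rho ->
    exists m : 'I_n, [/\ m \in minima, rho m = rho x & m <= x].
  move=> xD; have rxx : rho x == rho x by [].
  have [m /eqP rm minm] :=
    @arg_minnP _ x (fun y => rho y == rho x) (@nat_of_ord n) rxx.
  exists m; split=> //; last exact: minm.
  rewrite !inE rm; move: xD; rewrite inE => -> /=.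
  by apply/forallP => y; apply/implyP/minm.
have cmin : #|minima| <= p.
  apply: leq_trans cr; rewrite -[leqRHS](card_imset _ (@Some_inj _)).
  rewrite -[leqLHS](card_in_imset (f := rho)) => [|x y /setIdP[_ mx] /setIdP[_ my] rxy].
    apply/subset_leq_card/subsetP => _ /imsetP[x /setIdP[/DomP[y ry] _] ->].
    by rewrite ry imset_f //; apply/ImP; exists x.
  apply/val_inj/anti_leq.
  move/forallP/(_ y): mx; move/forallP/(_ x): my.
  by rewrite rxy eqxx /= => -> ->.
have [|M [minM MD cM]] := @exists_intermediate_set _ _ _ p minD.
  by rewrite cmin ltnW.
pose rhoM : ptrans n := [ffun x => if x \in M then rho x else None].
have rhoMP x a : rhoM x = Some a -> x \in M /\ rho x = Some a.
  by rewrite ffunE; case: ifP.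
have -> : rho = ptcomp (retract (Dom rho) M) rhoM.
  apply/ffunP => x; have [xD | xN] := boolP (x \in Dom rho); last first.
    by rewrite notin_Dom // ptcompN // retract_out.
  have [m [/(subsetP minM) Mm rm mx]] := minimum x xD.
  have [z rz] := retract_def xD Mm mx; rewrite (ptcompE _ rz).
  have /retractP[_ Mz zx maxz] := rz; rewrite ffunE Mz.
  (* From m <= z <= x and equal values at [m] and [x], isotonicity forces the same value at [z],
     even when [z] is a padding point. *)
  have mz := maxz _ Mm mx.
  have /DomP[c rc] := subsetP MD _ Mz; have /DomP[a ra] := xD; rewrite ra in rm.
  rewrite ra rc; congr Some; apply/val_inj/anti_leq.
  by rewrite (ir' _ _ _ _ zx rc ra) (ir' _ _ _ _ mz rm rc).
apply: generated_comp.
  apply/(subsetP EG)/mem_retractions => // x /minimum[m [/(subsetP minM) Mm _ mx]].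
  by exists m.
apply: isotone_small_generated.
- by apply/isotoneP => x y a c xy /rhoMP[_ rx] /rhoMP[_ ry]; apply: ir' rx ry.
- by apply/decreasingP => x a /rhoMP[_]; apply: dr'.
by rewrite -cM; apply/subset_leq_card/subsetP => x /DomP[y /rhoMP[]].
Qed.


End IsotoneGeneration.

(** * Truncated reflections and the factorization of antitone maps *)

Section Antitone.
Variable n : nat.
Implicit Types rho sigma tau : ptrans n.

Lemma reflection_lt p (k x : 'I_n) : k - minn (x - k) (p - 1) < n.
Proof. exact: leq_ltn_trans (leq_subr _ _) (ltn_ord k). Qed.

(** The map x to 2k - x on the points from [k] on, stopped at distance p - 1 from [k] to keep the
    rank at most p, and at 0 by truncated subtraction. *)
Definition reflection p (k : 'I_n) : ptrans n :=
  [ffun x : 'I_n => if k <= x then Some (Ordinal (reflection_lt p k x)) else None].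

Lemma reflectionE p k x y :
  reflection p k x = Some y -> k <= x /\ y = k - minn (x - k) (p - 1) :> nat.
Proof. by rewrite ffunE; case: ifP => // kx [<-]. Qed.

Lemma reflection_ideal p k : 0 < p -> reflection p k \in DORP_ideal n p.
Proof.
move=> p_gt0; apply/setIdP; split; last first.
  apply: (@leq_trans #|[set y : 'I_n | k - (p - 1) <= y < k.+1]|).
    apply/subset_leq_card/subsetP => y /ImP[x /reflectionE[kx yE]].
    by rewrite inE yE; lia.
  by apply: leq_trans (card_ord_range_le _ _ _) _; lia.
rewrite inE; apply/andP; split.
  apply/orP; right; apply/antitoneP => x y a b xy.
  by move=> /reflectionE[kx ->] /reflectionE[ky ->]; lia.
by apply/decreasingP => x a /reflectionE[kx ->]; lia.
Qed.

Lemma reflection_fix p k : reflection p k k = Some k.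
Proof. by rewrite ffunE leqnn; congr Some; apply: val_inj; rewrite /= subnn min0n subn0. Qed.

(** The bounds on [k] and p leave room for [k] and k + 1 to go to [k] and k - 1. *)
Lemma reflection_not_isotone p (k : 'I_n) : 1 < p -> 0 < k < n - 1 ->
  ~~ isotone (reflection p k).
Proof.
move=> p_gt1 /andP[k_gt0 kn]; have lekn : k.+1 < n by lia.
apply/negP => /isotoneP/(_ k (Ordinal lekn)); rewrite reflection_fix ffunE /= leqnSn.
by move=> /(_ _ _ isT erefl erefl) /=; lia.
Qed.

Lemma antitone_not_isotone rho :
  rho \in DORP n -> ~~ isotone rho -> antitone rho /\ decreasing rho.
Proof. by rewrite inE /monotone => /andP[/orP[->|]]. Qed.

Lemma fixed_point_uniq rho (j k : 'I_n) : rho \in DORP n -> ~~ isotone rho ->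
  rho j = Some j -> rho k = Some k -> j = k.
Proof.
move=> Dr /(antitone_not_isotone Dr)[/antitoneP ar _] rj rk; apply/val_inj/anti_leq/andP.
have /orP[jk | kj] := leq_total j k; first by split=> //; apply: ar jk rj rk.
by split=> //; apply: ar kj rk rj.
Qed.

Lemma ptcomp_isotone rho sigma : isotone rho -> isotone sigma -> isotone (ptcomp rho sigma).
Proof.
move=> /isotoneP ir /isotoneP is'; apply/isotoneP => x y a b xy.
by move=> /ptcompP[c rc sa] /ptcompP[d rd sb]; apply: is' sa sb; apply: ir rc rd.
Qed.

(** What the first factor lowers, the second cannot raise back. *)
Lemma ptcomp_fix rho sigma k : decreasing rho -> decreasing sigma ->
  ptcomp rho sigma k = Some k -> rho k = Some k /\ sigma k = Some k.
Proof.
move=> /decreasingP dr /decreasingP ds /ptcompP[a ra sa].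
have ak : a = k by apply/val_inj/anti_leq; rewrite dr //= ds.
by rewrite ak in ra sa.
Qed.

(* Writing b_1 > ... > b_r for the image of rho, whose blocks are A_1 < ... < A_r, and
   k = b_1 <= min A_1, the factors send A_i to k + i - 1, then to k - i + 1, then to b_i. *)
Lemma antitone_factor p rho : 0 < p -> rho \in DORP_ideal n p -> ~~ isotone rho ->
  exists (k : 'I_n) sigma tau,
   [/\ [/\ 0 < k < n - 1 & 1 < p],
       [/\ isotone sigma, decreasing sigma & #|Im sigma| <= p],
       [/\ isotone tau, decreasing tau & #|Im tau| <= p]
     & rho = ptcomp sigma (ptcomp (reflection p k) tau)].
Proof.
move=> p_gt0 /setIdP[Dr cr] nir; have [/antitoneP ar /decreasingP dr] := antitone_not_isotone Dr nir.
have [x1 [x2 [c1 [c2 [x12 r1 r2 c21]]]]] : exists x1 x2 c1 c2 : 'I_n,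
    [/\ x1 <= x2, rho x1 = Some c1, rho x2 = Some c2 & c2 < c1].
  move: nir => /forallPn[x1 /forallPn[x2 /forallPn[c1 /forallPn[c2]]]].
  rewrite negb_imply -ltnNge => /andP[/and3P[x12 /eqP r1 /eqP r2] c21].
  by exists x1, x2, c1, c2.
have Ic1 : c1 \in Im rho by apply/ImP; exists x1.
have Ic2 : c2 \in Im rho by apply/ImP; exists x2.
have [k Ik maxk] := @arg_maxnP _ c1 (fun b => b \in Im rho) (@nat_of_ord n) Ic1.
have /ImP[y1 ry1] := Ik.
have kmax x a : rho x = Some a -> a <= k by move=> rx; apply: maxk; apply/ImP; exists x.
have Dom_ge x a : rho x = Some a -> k <= x.
  move=> rx; have [y1x | /ltnW xy1] := leqP y1 x; first exact: leq_trans (dr _ _ ry1) y1x.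
  exact: leq_trans (ar _ _ _ _ xy1 rx ry1) (dr _ _ rx).
(* [C b] is i - 1 when [b] is the i-th largest image value. *)
pose C (b : 'I_n) := #|[set b' in Im rho | b < b']|.
have Cmono (b b' : 'I_n) : b <= b' -> C b' <= C b.
  move=> bb'; apply/subset_leq_card/subsetP => d; rewrite !in_set => /andP[-> /=].
  exact: leq_ltn_trans.
have Cstrict (b b' : 'I_n) : b' \in Im rho -> b < b' -> C b' < C b.
  move=> Ib' bb'; apply/proper_card/properP; split.
    apply/subsetP => d; rewrite !in_set => /andP[-> /=]; exact: ltn_trans.
  by exists b'; rewrite in_set Ib' ?ltnn.
have Clt b : b \in Im rho -> C b < p.
  move=> Ib; apply: leq_trans cr; apply/proper_card/properP; split.
    by apply/subsetP => d /setIdP[].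
  by exists b; rewrite // in_set ltnn andbF.
(* The image values above [b] lie in (b, k]. For [b] in the image this gives b <= k - C b, so that
   [tau] is decreasing. *)
have Ck b : C b <= k - b.
  apply: (@leq_trans #|[set y : 'I_n | b.+1 <= y < k.+1]|).
    apply/subset_leq_card/subsetP => d /setIdP[Id bd]; rewrite in_set ltnS.
    by rewrite bd; apply: maxk.
  by apply: leq_trans (card_ord_range_le _ _ _) _; lia.
(* By antitonicity, all preimages of the image values above [b] lie in [k, x), and distinct values
   have distinct preimages. Hence [insub] succeeds in [sigma], which is decreasing. *)
have Cx x b : rho x = Some b -> k + C b <= x.
  move=> rx; rewrite -leq_subRL ?(Dom_ge _ _ rx) //.
  apply: leq_trans (card_ord_range_le n k x).
  rewrite /C -[leqLHS](card_imset _ (@Some_inj _)).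
  apply: leq_trans (leq_imset_card rho _).
  apply/subset_leq_card/subsetP => _ /imsetP[d /setIdP[/ImP[z rz] bd] ->].
  rewrite -rz imset_f // in_set (Dom_ge _ _ rz) /= ltnNge; apply/negP => xz.
  by have := ar _ _ _ _ xz rx rz; rewrite leqNgt bd.
pose sigma : ptrans n := [ffun x => obind (fun b => insub (k + C b)) (rho x)].
pose tau : ptrans n := [ffun j : 'I_n => [pick b in Im rho | (j : nat) == k - C b]].
have sigmaE x b y : rho x = Some b -> sigma x = Some y <-> y = k + C b :> nat.
  move=> rx; rewrite ffunE rx /=; have kCn := leq_ltn_trans (Cx _ _ rx) (ltn_ord x).
  by rewrite insubT; split=> [[<-] // | yE]; congr Some; apply: val_inj.
have sigmaP x y : sigma x = Some y -> exists2 b, rho x = Some b & y = k + C b :> nat.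
  case rx: (rho x) => [b|]; last by rewrite ffunE rx.
  by move/(sigmaE _ _ _ rx) => yE; exists b.
have tauP j b : tau j = Some b -> b \in Im rho /\ j = k - C b :> nat.
  by rewrite ffunE; case: pickP => // b' /andP[Ib' /eqP jE] [<-].
have Cinj b b' : b \in Im rho -> b' \in Im rho -> k - C b = k - C b' -> b = b'.
  move=> Ib Ib' E; apply/val_inj; case: (ltngtP b b') => // lt.
    by have := Cstrict _ _ Ib' lt; have := Ck b; have := Ck b'; lia.
  by have := Cstrict _ _ Ib lt; have := Ck b; have := Ck b'; lia.
exists k, sigma, tau; split.
- have := kmax _ _ r1; have := Dom_ge _ _ r1; have := ltn_ord x2.
  have x1x2 : x1 < x2.
    rewrite ltn_neqAle x12 andbT; apply/eqP => /val_inj x1x2.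
    by move: c21; move: r2; rewrite -x1x2 r1 => -[->]; rewrite ltnn.
  split; first by lia.
  apply: leq_trans cr; apply/card_gt1P; exists c1, c2; split=> //.
  by apply: contraTneq c21 => ->; rewrite ltnn.
- split.
  + apply/isotoneP => x y a b xy /sigmaP[c rx ->] /sigmaP[d ry ->].
    by rewrite leq_add2l Cmono // (ar _ _ _ _ xy rx ry).
  + by apply/decreasingP => x a /sigmaP[c rx ->]; apply: Cx.
  apply: leq_trans cr; rewrite -(card_imset _ (@Some_inj _)).
  apply: leq_trans (leq_imset_card (fun b => insub (k + C b)) _).
  apply/subset_leq_card/subsetP => _ /imsetP[y /ImP[x sx] ->].
  have [b rx yE] := sigmaP _ _ sx; apply/imsetP; exists b; first by apply/ImP; exists x.
  by rewrite -sx ffunE rx.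
- split.
  + apply/isotoneP => i j a b ij /tauP[Ia iE] /tauP[Ib jE]; rewrite leqNgt; apply/negP => ba.
    by have := Cstrict _ _ Ia ba; have := Ck a; have := Ck b; lia.
  + by apply/decreasingP => j b /tauP[Ib ->]; have := Ck b; have /ImP[x /kmax] := Ib; lia.
  apply: leq_trans cr; apply/subset_leq_card/subsetP => b /ImP[j /tauP[]] //.
apply/ffunP => x; case rx: (rho x) => [b|]; last by rewrite ptcompN // ffunE rx.
have Ib : b \in Im rho by apply/ImP; exists x.
have kCn := leq_ltn_trans (Cx _ _ rx) (ltn_ord x).
have sx : sigma x = Some (Ordinal kCn) by apply/(sigmaE _ _ _ rx).
have lt : k - C b < n by apply: leq_ltn_trans (leq_subr _ _) (ltn_ord k).
(* By [Clt], C b <= p - 1, so the truncation in the reflection has no effect here. *)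
have rE : reflection p k (Ordinal kCn) = Some (Ordinal lt).
  by rewrite ffunE /= leq_addr; congr Some; apply: val_inj => /=; have := Clt b Ib; lia.
rewrite (ptcompE _ sx) (ptcompE _ rE) ffunE.
case: pickP => [b' /andP[Ib' /eqP /= E] | /(_ b)]; last by rewrite Ib eqxx.
by congr Some; apply: Cinj.
Qed.

End Antitone.

(** * Minimal generating sets for positive p *)

Section Rank.
Variables (n p : nat).
Hypotheses (p_gt0 : 0 < p) (pn : p < n).

(** Zero-based form of the points other than 1 and n. A non-isotone map of the monoid cannot fix an
    end point: fixing the least makes it constant, fixing the greatest leaves one point in its
    domain. *)
Definition inner_points : {set 'I_n} := [set k : 'I_n | 0 < k < n - 1].

Lemma card_inner_points : #|inner_points| = n - 2.
Proof.
rewrite cardE -(size_map val) -(size_iota 1 (n - 2)).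
apply/perm_size/uniq_perm; rewrite ?iota_uniq ?map_inj_uniq ?enum_uniq //; first exact: val_inj.
move=> i; rewrite mem_iota; apply/mapP/idP => [[k + ->] | iP].
  by rewrite mem_enum inE /=; lia.
have ltin : i < n by lia.
by exists (Ordinal ltin); rewrite // mem_enum inE /=; lia.
Qed.

Lemma retractions_ideal : retractions n p \subset DORP_ideal n p.
Proof.
apply/subsetP => _ /imsetP[[A M] /retract_pairsP[MA cM H] ->] /=.
apply/setIdP; split; last by rewrite Im_retract ?cM.
by rewrite inE /monotone retract_isotone retract_decreasing.
Qed.

Lemma ideal_generated (G : {set ptrans n}) : subsemigroup ptcomp G ->
  retractions n p \subset G ->
  (1 < p -> forall k, k \in inner_points -> reflection p k \in G) ->
  DORP_ideal n p \subset G.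
Proof.
move=> sG EG refG; apply/subsetP => rho Ir.
have /setIdP[/setIdP[_ dr] cr] := Ir.
have [ir | nir] := boolP (isotone rho); first exact: (isotone_generated p_gt0 pn).
have [k [sigma [tau [[kK p_gt1] [is' ds cs] [it dt ct] ->]]]] := antitone_factor p_gt0 Ir nir.
apply: (generated_comp sG); first exact: (isotone_generated p_gt0 pn).
apply: (generated_comp sG); last exact: (isotone_generated p_gt0 pn).
by apply: refG; rewrite ?inE.
Qed.

Lemma retractions_sub_generators T :
  generates ptcomp T (DORP_ideal n p) -> retractions n p \subset T.
Proof.
move=> gT; apply/subsetP => e eE; have Ie := subsetP retractions_ideal _ eE.
have [||t tT /eqP <- //] :=
  generates_meets (W := pred1 e) (DORP_ideal_subsemigroup n p) gT Ie; rewrite /= ?eqxx //.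
move=> a b Ia Ib /eqP eqe; apply/orP; left; apply/eqP.
have /imsetP[[A M] AM eAM] := eE; move: eqe.
rewrite eAM => eqe; exact: retract_left_factor AM Ia Ib eqe.
Qed.

(* For each inner point k, the non-isotone maps of the ideal fixing k form the complement
   of a subsemigroup, and no such map fixes two points. *)
Lemma generators_not_isotone T : 1 < p ->
  generates ptcomp T (DORP_ideal n p) -> n - 2 <= #|[set t in T | ~~ isotone t]|.
Proof.
move=> p_gt1 gT; have /andP[/subsetP TI _] := gT.
have TD t : t \in T -> t \in DORP n by move=> /TI/setIdP[].
(* Sending each map to a fixed point, if it has one, must reach every inner point; this bounds their
   number. *)
rewrite -card_inner_points -(card_imset _ (@Some_inj _)).
apply: leq_trans (leq_imset_card (fun t : ptrans n => [pick k | t k == Some k]) _).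
apply/subset_leq_card/subsetP => _ /imsetP[k + ->]; rewrite inE => kK.
have [|a b|t tT /andP[nit /eqP tk]] := generates_meets
    (W := fun t : ptrans n => ~~ isotone t && (t k == Some k))
    (DORP_ideal_subsemigroup n p) gT (reflection_ideal k p_gt0).
- by rewrite reflection_not_isotone //= reflection_fix.
- move=> /setIdP[/setIdP[_ da] _] /setIdP[/setIdP[_ db] _] /= /andP[niab /eqP abk].
  have [-> ->] := ptcomp_fix da db abk; rewrite !eqxx !andbT -negb_and.
  by apply: contra niab => /andP[ia ib]; apply: ptcomp_isotone.
apply/imsetP; exists t; first by rewrite inE tT.
case: pickP => [j /eqP tj | /(_ k)]; last by rewrite tk eqxx.
by congr Some; apply: fixed_point_uniq tk tj => //; apply: TD.
Qed.

Lemma rank_ideal :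
  rank ptcomp (DORP_ideal n p) = (if p == 1 then 0 else n - 2) + #|retractions n p|.
Proof.
have [[T gT cT] minT] := rankP (DORP_ideal_subsemigroup n p).
(* For p = 1 the reflections are constant, hence isotone and already generated by the
   retractions. *)
pose R := if p == 1 then set0 else [set reflection p k | k in inner_points].
have cR : #|R| <= if p == 1 then 0 else n - 2.
  rewrite /R; case: ifP => _; first by rewrite cards0.
  by rewrite -card_inner_points leq_imset_card.
apply/eqP; rewrite eqn_leq; apply/andP; split.
  have gRE : generates ptcomp (R :|: retractions n p) (DORP_ideal n p).
    have REI : R :|: retractions n p \subset DORP_ideal n p.
      rewrite subUset retractions_ideal andbT /R; case: ifP => _; first exact: sub0set.
      by apply/subsetP => _ /imsetP[k _ ->]; apply: reflection_ideal.
    rewrite /generates REI eqEsubset generated_min ?DORP_ideal_subsemigroup //=.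
    apply: ideal_generated (generated_subsemigroup _ _) _ _.
      exact: subset_trans (subsetUr _ _) (subset_generated _ _).
    move=> p_gt1 k kK; apply: (subsetP (subset_generated _ _)); rewrite inE /R.
    by rewrite gtn_eqF // imset_f.
  by apply: leq_trans (minT _ gRE) _; rewrite cardsU (leq_trans (leq_subr _ _)) ?leq_add2r.
(* The isotone and the non-isotone members of [T] are counted separately: the former include all
   retractions. *)
rewrite -cT -(cardsID [set t | isotone t] T) addnC leq_add //.
  apply/subset_leq_card; rewrite subsetI (retractions_sub_generators gT) /=.
  by apply/subsetP => _ /imsetP[AM _ ->]; rewrite inE retract_isotone.
case: eqVneq => // p1; have p_gt1 : 1 < p by rewrite ltn_neqAle eq_sym p1.
apply: leq_trans (generators_not_isotone p_gt1 gT) _.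
by apply/subset_leq_card/subsetP => t; rewrite !inE andbC.
Qed.

End Rank.

(** * The case p = 0 and the closed formula *)

Lemma rank_ideal0 n : rank ptcomp (DORP_ideal n 0) = 1.
Proof.
pose e : ptrans n := [ffun=> None].
have I0 : DORP_ideal n 0 = [set e].
  apply/setP => rho; rewrite in_set1; apply/setIdP/eqP => [[_] | ->].
    rewrite leqn0 cards_eq0 => /eqP I0; apply/ffunP => x; rewrite ffunE.
    case rx: (rho x) => [a|] //; have : a \in Im rho by apply/ImP; exists x.
    by rewrite I0 inE.
  have eN x a : e x = Some a -> False by rewrite ffunE.
  split; last first.
    by rewrite leqn0 cards_eq0 -subset0; apply/subsetP => y /ImP[x /eN].
  rewrite inE; apply/andP; split; last by apply/decreasingP => x a /eN.
  by apply/orP; left; apply/isotoneP => x y a b _ /eN.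
have [[T /andP[TI /eqP gT] <-] _] := rankP (DORP_ideal_subsemigroup n 0).
rewrite I0 in TI gT; apply/eqP; rewrite eqn_leq -{1}(cards1 e) subset_leq_card //=.
(* The empty set is itself a subsemigroup, so it cannot generate the empty map [e]. *)
rewrite card_gt0; apply/eqP => T0; suff: [set e] \subset set0.
  by rewrite subset0 -cards_eq0 cards1.
rewrite -gT T0; apply: generated_min (sub0set _).
by apply/forall_inP => x; rewrite inE.
Qed.

Theorem theorem3p19 (n p : nat) (hn : 1 <= n) (hp : p <= n - 1) :
  rank ptcomp (DORP_ideal n p) =
    if p == 0 then 1
    else if p == 1 then 2 ^ n - 1
    else (n - 2) + \sum_(p <= r < n.+1) 'C(n, r) * 'C(r - 1, p - 1).
Proof.
case: eqVneq => [-> | p0]; first exact: rank_ideal0.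
have p_gt0 : 0 < p by rewrite lt0n.
have pn : p < n by lia.
rewrite (rank_ideal p_gt0 pn) card_retractions card_retract_pairs; last by rewrite p_gt0 ltnW.
(* For p = 1 the second binomial is 1, leaving the row sum 2 ^ n without its r = 0 term. *)
case: eqVneq => [-> | //]; rewrite add0n.
have -> : 2 ^ n = \sum_(0 <= r < n.+1) 'C(n, r).
  rewrite -[2]/(1 + 1) expnDn big_mkord; apply: eq_bigr => r _.
  by rewrite !exp1n !muln1.
rewrite [in RHS]big_ltn // bin0 addKn; apply: eq_bigr => r _.
by rewrite subnn bin0 muln1.
Qed.
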